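(* (1) For every directed space $X$, every $\vee$-$\wedge$-directed space $Y$, and every continuous map $f:X\to Y$, there is a unique $\vee$-$\wedge$-morphism $F:P_L(P_U(X))\to Y$ such that $F\circ(\eta_\vee\circ\eta_\wedge)=f$. This $F$ is given by $P_L(P_U(f))$. Thus $P_L(P_U(X))$ is the free $\vee$-$\wedge$-directed space over the directed space $X$. (2) For every directed space $X$, every $\vee$-$\wedge$-directed space $Y$, and every continuous map $f:X\to Y$, there is a unique $\vee$-$\wedge$-morphism $F:P_U(P_L(X))\to Y$ such that $F\circ(\eta_\wedge\circ\eta_\vee)=f$. This $F$ is given by $P_U(P_L(f))$. Thus $P_U(P_L(X))$ is the free $\vee$-$\wedge$-directed space over the directed space $X$. (3) For every directed space $X$, $P_L(P_U(X))$ and $P_U(P_L(X))$ are isomorphic by a $\vee$-$\wedge$-morphism which maps $\uparrow(\downarrow x)$ to $\downarrow(\uparrow x)$ for $x\in X$.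
   Context: All topological spaces are $T_0$. For a $T_0$ space $X$ with topology $O(X)$, the specialization order is $x\sqsubseteq y \iff x\in\overline{\{y\}}$; all order-theoretic notions on a space refer to it (also written $\le$). For $A\subseteq X$, $\uparrow A=\{x:\exists a\in A,\ a\sqsubseteq x\}$, $\downarrow A=\{x:\exists a\in A,\ x\sqsubseteq a\}$. A directed set is a nonempty subset in which every nonempty finite subset has an upper bound. A directed set $D\subseteq X$, viewed as a net indexed by itself, converges to $x$, written $D\to x$, if it is eventually in every open neighbourhood of $x$; $\lim D$ denotes the set of all $x$ with $D\to x$. A subset $U\subseteq X$ is directed open if for every directed $D\subseteq X$ and $x\in U$ with $D\to x$ one has $D\cap U\ne\emptyset$; $d(X)$ is the family of directed open sets. $X$ is a directed space if it is $T_0$ and $d(X)=O(X)$. For directed spaces $X,Y$, $X\otimes Y$ is the set $X\times Y$ with the topology in which $U$ is open iff for every pointwise-directed $D\subseteq X\times Y$ and $(x,y)\in U$ with $\pi_1D\to x$ in $X$ and $\pi_2D\to y$ in $Y$ one has $U\cap D\ne\emptyset$. A $\vee$-directed space (directed inflationary semilattice) is a directed space $X$ with a continuous operation $X\otimes X\to X$ that is idempotent, associative, commutative and satisfies $x\oplus y\ge x$; such an operation is the binary supremum $\vee$ of the specialization order. A $\wedge$-directed space (directed deflationary semilattice) is defined in the same way with $x\oplus y\le x$; the operation is the binary infimum $\wedge$. A $\vee$-morphism (resp. $\wedge$-morphism) is a continuous map preserving $\vee$ (resp. $\wedge$). A $\vee$-$\wedge$-directed space is a directed space that is both a $\vee$-directed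 space and a $\wedge$-directed space and satisfies $a\wedge(b\vee c)=(a\wedge b)\vee(a\wedge c)$ for all $a,b,c$. A $\vee$-$\wedge$-morphism is a map between such spaces that is both a $\vee$-morphism and a $\wedge$-morphism. Lower powerspace: $P_L(X)$ is the set $LX=\{\downarrow F: F\text{ a nonempty finite subset of }X\}$ ordered by inclusion, with operation $\downarrow F_1\cup\downarrow F_2=\downarrow(F_1\cup F_2)$. For an inclusion-directed $\mathcal D\subseteq LX$, $\mathcal D\Rightarrow_L\downarrow F$ means that for every $a\in F$ there is a directed $D_a\subseteq X$ with $D_a\subseteq\bigcup\mathcal D$ and $D_a\to a$. The open sets of $P_L(X)$ are the $\mathcal U\subseteq LX$ such that $\mathcal D\Rightarrow_L\downarrow F\in\mathcal U$ implies $\mathcal D\cap\mathcal U\neq\emptyset$. Put $\eta_\vee:X\to P_L(X)$, $\eta_\vee(x)=\downarrow x$. $P_L(X)$ is the free $\vee$-directed space over $X$ with unit $\eta_\vee$. Upper powerspace: $P_U(X)$ is the set $UX=\{\uparrow F: F\text{ a nonempty finite subset of }X\}$ ordered by reverse inclusion, with operation $\uparrow F_1\cup\uparrow F_2=\uparrow(F_1\cup F_2)$. For $\mathcal F\subseteq UX$ directed in this order, $\mathcal F\Rightarrow_U\uparrow F$ means that there are finitely many directed $D_1,\dots,D_n\subseteq X$ with $F\cap\lim D_i\ne\emptyset$ for all $i$, $F\subseteq\bigcup_i\lim D_i$, and for each $(d_1,\dots,d_n)\in\prod_iD_i$ some $\uparrow F'\in\mathcal F$ with $\uparrow F'\subseteq\bigcup_i\uparrow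 d_i$. The open sets of $P_U(X)$ are the $\mathcal U\subseteq UX$ such that $\mathcal F\Rightarrow_U\uparrow F\in\mathcal U$ implies $\mathcal F\cap\mathcal U\ne\emptyset$. Put $\eta_\wedge:X\to P_U(X)$, $\eta_\wedge(x)=\uparrow x$. $P_U(X)$ is the free $\wedge$-directed space over $X$ with unit $\eta_\wedge$. In this result, for a continuous $g:X\to Y$ into a $\vee$-directed space, $P_L(g):P_L(X)\to Y$ denotes its unique extension to a $\vee$-morphism, i.e. $P_L(g)(\downarrow F)=\bigvee_{a\in F}g(a)$; for a continuous $g:X\to Y$ into a $\wedge$-directed space, $P_U(g):P_U(X)\to Y$ denotes its unique extension to a $\wedge$-morphism, i.e. $P_U(g)(\uparrow F)=\bigwedge_{a\in F}g(a)$. In the compositions $\eta_\vee\circ\eta_\wedge$ and $\eta_\wedge\circ\eta_\vee$, the second map applied is the unit of the powerspace of $P_U(X)$, respectively $P_L(X)$. *)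

(* Defs.v *)
From HB Require Import structures.
From mathcomp Require Import all_boot finmap.
From mathcomp Require Import mathcomp_extra boolp classical_sets functions.
From mathcomp Require Import cardinality filter topology.

Set Implicit Arguments.
Unset Strict Implicit.
Unset Printing Implicit Defensive.

Local Open Scope classical_set_scope.

Section ConvergenceTopology.
Context {T : Type}.
Implicit Types (le : T -> T -> Prop) (conv : set T -> T -> Prop).

Definition directed_subset le (D : set T) : Prop :=
  D !=set0 /\
  forall A, A `<=` D -> finite_set A -> A !=set0 ->
    exists2 z, D z & forall a, A a -> le a z.

Definition conv_open le conv (U : set T) : Prop :=
  forall D x, directed_subset le D -> conv D x -> U x -> D `&` U !=set0.

Lemma directed_subset1 le x : (forall y, le y y) -> directed_subset le [set x].
Proof.
move=> lexx; split; first by exists x.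
by move=> A A1 _ _; exists x => // a /A1 ->.
Qed.

Section Topology.
Variables (le : T -> T -> Prop) (conv : set T -> T -> Prop).
Hypothesis lexx : forall x, le x x.
Hypothesis conv1 : forall x y, le x y -> conv [set y] x.

Lemma conv_open_up U x y : conv_open le conv U -> le x y -> U x -> U y.
Proof.
move=> Uo xy Ux.
by have [_ [-> //]] := Uo _ _ (directed_subset1 y lexx) (conv1 xy) Ux.
Qed.

Lemma conv_openT : conv_open le conv setT.
Proof. by move=> D x [[d Dd] _] _ _; exists d. Qed.

Lemma conv_openI : setI_closed (conv_open le conv).
Proof.
move=> U V Uo Vo D x dD Dx [Ux Vx].
have [d [Dd Ud]] := Uo _ _ dD Dx Ux.
have [e [De Ve]] := Vo _ _ dD Dx Vx.
have [|||z Dz Hz] := dD.2 [set d; e].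
- by move=> _ [->|->].
- exact: finite_set2.
- by exists d; left.
exists z; split=> //; split.
- by apply: conv_open_up Uo _ Ud; apply: Hz; left.
- by apply: conv_open_up Vo _ Ve; apply: Hz; right.
Qed.

Lemma conv_open_bigU (I : Type) (f : I -> set T) :
  (forall i, conv_open le conv (f i)) -> conv_open le conv (\bigcup_i f i).
Proof.
move=> fo D x dD Dx [i _ fx]; have [d [Dd fd]] := fo i _ _ dD Dx fx.
by exists d; split=> //; exists i.
Qed.

End Topology.
End ConvergenceTopology.

Section DirectedSpace.
Context {X : topologicalType}.
Implicit Types (x y : X) (A D U : set X).

Definition spec_le x y : Prop := closure [set y] x.

Definition upset A : set X := [set x | exists2 a, A a & spec_le a x].
Definition downset A : set X := [set x | exists2 a, A a & spec_le x a].

Definition converges D x : Prop :=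
  forall U, open U -> U x ->
    exists2 d0, D d0 & forall d, D d -> spec_le d0 d -> U d.

Definition directed_open : set X -> Prop := conv_open spec_le converges.

End DirectedSpace.

Definition directed_space (X : topologicalType) : Prop :=
  kolmogorov_space X /\ forall U : set X, directed_open U <-> open U.

Section SpecializationOrder.
Context {X : topologicalType}.
Implicit Types (x y z : X) (A D U : set X).

Lemma spec_leP x y : spec_le x y <-> forall U, open U -> U x -> U y.
Proof.
split=> [xy U Uo Ux|H B].
  by have [|_ [-> //]] := xy U; exact: open_nbhs_nbhs.
rewrite nbhsE => -[U [Uo Ux] UB]; exists y; split=> //.
by apply: UB; exact: H Ux.
Qed.

Lemma spec_le_refl x : spec_le x x.
Proof. exact/spec_leP. Qed.

Lemma spec_le_trans y x z : spec_le x y -> spec_le y z -> spec_le x z.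
Proof.
move=> /spec_leP xy /spec_leP yz; apply/spec_leP => U Uo Ux.
exact: yz (xy _ Uo Ux).
Qed.

Lemma spec_le_anti x y :
  kolmogorov_space X -> spec_le x y -> spec_le y x -> x = y.
Proof.
move=> X0 xy yx; apply/eqP/negP => /negP /X0[A].
case=> -[/set_mem An /set_mem]; apply.
  by have [_ [-> //]] := xy _ An.
by have [_ [-> //]] := yx _ An.
Qed.

Lemma converges1 x y : spec_le x y -> converges [set y] x.
Proof. by move=> /spec_leP xy U Uo Ux; exists y => // _ -> _; exact: xy Ux. Qed.

Lemma upset_le A x y : upset A x -> spec_le x y -> upset A y.
Proof. by move=> [a Aa ax] xy; exists a => //; exact: spec_le_trans xy. Qed.

Lemma downset_le A x y : downset A x -> spec_le y x -> downset A y.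
Proof. by move=> [a Aa xa] yx; exists a => //; exact: spec_le_trans xa. Qed.

Lemma upsetS A : A `<=` upset A.
Proof. by move=> a Aa; exists a => //; exact: spec_le_refl. Qed.

Lemma downsetS A : A `<=` downset A.
Proof. by move=> a Aa; exists a => //; exact: spec_le_refl. Qed.

Lemma upsetU A B : upset (A `|` B) = upset A `|` upset B.
Proof.
apply/seteqP; split=> x.
  by move=> [a [Aa|Ba] ax]; [left|right]; exists a.
by case=> -[a Aa ax]; exists a => //; [left|right].
Qed.

Lemma downsetU A B : downset (A `|` B) = downset A `|` downset B.
Proof.
apply/seteqP; split=> x.
  by move=> [a [Aa|Ba] ax]; [left|right]; exists a.
by case=> -[a Aa ax]; exists a => //; [left|right].
Qed.

End SpecializationOrder.

Lemma continuous_spec_le (X Y : topologicalType) (f : X -> Y) x y :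
  continuous f -> spec_le x y -> spec_le (f x) (f y).
Proof.
move=> fc /spec_leP xy; apply/spec_leP => U Uo Ufx.
by apply: (xy (f @^-1` U)) => //; exact: open_comp.
Qed.

(* An alias of [X * Y], so that the instance below does not clash with the
   product topology. *)
Definition tensor (X Y : topologicalType) : Type := (X * Y)%type.
HB.instance Definition _ (X Y : topologicalType) :=
  Choice.copy (tensor X Y) (X * Y)%type.

Section Tensor.
Variables X Y : topologicalType.

Definition tensor_le (p q : tensor X Y) : Prop :=
  spec_le p.1 q.1 /\ spec_le p.2 q.2.

Definition tensor_converges (D : set (tensor X Y)) (p : tensor X Y) : Prop :=
  converges [set q.1 | q in D] p.1 /\ converges [set q.2 | q in D] p.2.

Definition tensor_open : set (tensor X Y) -> Prop :=
  conv_open tensor_le tensor_converges.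

Lemma tensor_le_refl p : tensor_le p p.
Proof. by split; exact: spec_le_refl. Qed.

Lemma tensor_converges1 p q : tensor_le p q -> tensor_converges [set q] p.
Proof. by move=> [? ?]; split; rewrite image_set1; exact: converges1. Qed.

HB.instance Definition _ := isOpenTopological.Build (tensor X Y)
  (@conv_openT _ tensor_le tensor_converges)
  (conv_openI tensor_le_refl tensor_converges1)
  (@conv_open_bigU _ tensor_le tensor_converges).

End Tensor.

Section Semilattices.
Variable X : topologicalType.
Implicit Types op join meet : X -> X -> X.

Record directed_semilattice op : Prop := {
  dsl_space : directed_space X;
  dsl_continuous : continuous (fun p : tensor X X => op p.1 p.2);
  dsl_idempotent : idempotent_op op;
  dsl_associative : associative op;
  dsl_commutative : commutative op }.

Definition vee_directed join : Prop :=
  directed_semilattice join /\ forall x y, spec_le x (join x y).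

Definition wedge_directed meet : Prop :=
  directed_semilattice meet /\ forall x y, spec_le (meet x y) x.

Definition vee_wedge_directed join meet : Prop :=
  [/\ vee_directed join, wedge_directed meet &
      forall a b c, meet a (join b c) = join (meet a b) (meet a c)].

End Semilattices.

Section Morphisms.
Variables X Y : topologicalType.

(* A join-morphism when the operations are the joins, a meet-morphism when
   they are the meets. *)
Definition semilattice_morphism (opX : X -> X -> X) (opY : Y -> Y -> Y)
    (F : X -> Y) : Prop :=
  continuous F /\ {morph F : x y / opX x y >-> opY x y}.

Definition vee_wedge_morphism (joinX meetX : X -> X -> X)
    (joinY meetY : Y -> Y -> Y) (F : X -> Y) : Prop :=
  semilattice_morphism joinX joinY F /\ semilattice_morphism meetX meetY F.

End Morphisms.

Definition free_vee_wedge_directed (X Z : topologicalType)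
    (joinZ meetZ : Z -> Z -> Z) (eta : X -> Z) : Prop :=
  [/\ vee_wedge_directed joinZ meetZ,
      continuous eta &
      forall (Y : topologicalType) (joinY meetY : Y -> Y -> Y),
        vee_wedge_directed joinY meetY ->
        forall f : X -> Y, continuous f ->
        exists! F : Z -> Y,
          vee_wedge_morphism joinZ meetZ joinY meetY F /\ F \o eta = f].

Record lower_powerspace (X : topologicalType) : Type := LowerPowerspace {
  lower_set :> set X;
  lower_setP : exists F, [/\ finite_set F, F !=set0 & lower_set = downset F] }.

HB.instance Definition _ (X : topologicalType) :=
  gen_eqMixin (lower_powerspace X).
HB.instance Definition _ (X : topologicalType) :=
  gen_choiceMixin (lower_powerspace X).

Section LowerPowerspace.
Variable X : topologicalType.
Local Notation LX := (lower_powerspace X).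
Implicit Types A B : LX.

Definition lower_fin (F : set X) (fF : finite_set F) (F0 : F !=set0) : LX :=
  LowerPowerspace (ex_intro _ F (And3 fF F0 erefl)).

Definition lower_le A B : Prop := A `<=` B.

Definition lower_converges (D : set LX) (A : LX) : Prop :=
  exists F, [/\ finite_set F, F !=set0, A = downset F :> set X &
    forall a, F a -> exists Da,
      [/\ directed_subset spec_le Da, Da `<=` \bigcup_(B in D) B &
          converges Da a]].

Definition lower_open : set LX -> Prop := conv_open lower_le lower_converges.

Lemma lower_le_refl A : lower_le A A.
Proof. by []. Qed.

Lemma lower_converges1 A B : lower_le A B -> lower_converges [set B] A.
Proof.
move=> AB; have [F [fF F0 AF]] := lower_setP A; exists F; split=> // a Fa.
exists [set a]; split.
- by apply: directed_subset1; exact: spec_le_refl.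
- move=> _ ->; exists B => //; apply: AB; rewrite /= AF; exact: downsetS.
- by apply: converges1; exact: spec_le_refl.
Qed.

HB.instance Definition _ := isOpenTopological.Build (lower_powerspace X)
  (@conv_openT _ lower_le lower_converges)
  (conv_openI lower_le_refl lower_converges1)
  (@conv_open_bigU _ lower_le lower_converges).

Lemma lower_join_subproof A B : exists F,
  [/\ finite_set F, F !=set0 & A `|` B = downset F].
Proof.
have [F [fF [x Fx] ->]] := lower_setP A; have [G [fG _ ->]] := lower_setP B.
exists (F `|` G); split; [by rewrite finite_setU|by exists x; left|].
by rewrite downsetU.
Qed.

Definition lower_join A B : LX := LowerPowerspace (lower_join_subproof A B).

Definition eta_vee (x : X) : LX := lower_fin (finite_set1 x) (ex_intro _ x erefl).

End LowerPowerspace.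

Record upper_powerspace (X : topologicalType) : Type := UpperPowerspace {
  upper_set :> set X;
  upper_setP : exists F, [/\ finite_set F, F !=set0 & upper_set = upset F] }.

HB.instance Definition _ (X : topologicalType) :=
  gen_eqMixin (upper_powerspace X).
HB.instance Definition _ (X : topologicalType) :=
  gen_choiceMixin (upper_powerspace X).

Section UpperPowerspace.
Variable X : topologicalType.
Local Notation UX := (upper_powerspace X).
Implicit Types A B : UX.

Definition upper_fin (F : set X) (fF : finite_set F) (F0 : F !=set0) : UX :=
  UpperPowerspace (ex_intro _ F (And3 fF F0 erefl)).

Definition upper_le A B : Prop := B `<=` A.

(* The finite set generating the limit is existentially quantified: the
   condition depends on the generators and not only on the upper set [A], and
   an open set has to be met as soon as it holds for some generating set. *)
Definition upper_converges (D : set UX) (A : UX) : Prop :=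
  exists F, [/\ finite_set F, F !=set0, A = upset F :> set X &
    exists (n : nat) (Ds : 'I_n -> set X),
      [/\ forall i, directed_subset spec_le (Ds i),
          forall i, F `&` converges (Ds i) !=set0,
          F `<=` \bigcup_i converges (Ds i) &
          forall d : 'I_n -> X, (forall i, Ds i (d i)) ->
            exists2 B, D B & B `<=` \bigcup_i upset [set d i]]].

Definition upper_open : set UX -> Prop := conv_open upper_le upper_converges.

Lemma upper_le_refl A : upper_le A A.
Proof. by []. Qed.

Lemma upper_converges1 A B : upper_le A B -> upper_converges [set B] A.
Proof.
move=> AB; have [F [fF F0 AF]] := upper_setP A; exists F; split=> //.
pose s : seq X := fset_set F.
have sF x : (x \in s) <-> F x.
  by rewrite /s (_ : (_ \in _) = (x \in fset_set F)) // in_fset_set // inE.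
exists (size s), (fun i => [set tnth (in_tuple s) i]); split.
- by move=> i; apply: directed_subset1; exact: spec_le_refl.
- move=> i; exists (tnth (in_tuple s) i); split.
    by apply/sF; exact: mem_tnth.
  by apply: converges1; exact: spec_le_refl.
- move=> x /sF xs; have /tnthP[i xi] : x \in in_tuple s by [].
  by exists i => //; rewrite xi; apply: converges1; exact: spec_le_refl.
- move=> d dE; exists B => // x /AB; rewrite AF => -[a /sF aF ax].
  have /tnthP[i ai] : a \in in_tuple s by [].
  by exists i => //; exists a => //; rewrite ai -(dE i).
Qed.

HB.instance Definition _ := isOpenTopological.Build (upper_powerspace X)
  (@conv_openT _ upper_le upper_converges)
  (conv_openI upper_le_refl upper_converges1)
  (@conv_open_bigU _ upper_le upper_converges).

Lemma upper_meet_subproof A B : exists F,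
  [/\ finite_set F, F !=set0 & A `|` B = upset F].
Proof.
have [F [fF [x Fx] ->]] := upper_setP A; have [G [fG _ ->]] := upper_setP B.
exists (F `|` G); split; [by rewrite finite_setU|by exists x; left|].
by rewrite upsetU.
Qed.

Definition upper_meet A B : UX := UpperPowerspace (upper_meet_subproof A B).

Definition eta_wedge (x : X) : UX :=
  upper_fin (finite_set1 x) (ex_intro _ x erefl).

End UpperPowerspace.

Section Extension.
Variables X Y : topologicalType.
Implicit Types (op : Y -> Y -> Y) (g : X -> Y) (F : set X).

(* The iteration of [op] over [g a], for [a] in the nonempty finite set [F].
   There is no unit to start from, so an element of [F] is used twice; this is
   harmless when [op] is idempotent, commutative and associative. *)
Definition fold_set op g F (F0 : F !=set0) : Y :=
  foldr (fun a => op (g a)) (g (sval (cid F0))) (fset_set F).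

(* The maps P_L(g) and P_U(g), computed on a chosen finite set of generators;
   [lower_ext_fin] and [upper_ext_fin] below show that any finite set of
   generators gives the same value. *)
Definition lower_ext (join : Y -> Y -> Y) g (A : lower_powerspace X) : Y :=
  let: exist _ (And3 _ F0 _) := cid (lower_setP A) in fold_set join g F0.

Definition upper_ext (meet : Y -> Y -> Y) g (A : upper_powerspace X) : Y :=
  let: exist _ (And3 _ F0 _) := cid (upper_setP A) in fold_set meet g F0.

Section Fold.
Variables (R : Y -> Y -> Prop) (op : Y -> Y -> Y).
Hypothesis opxx : idempotent_op op.
Hypothesis opR : forall x y, R x (op x y).
Hypothesis opC : commutative op.
Hypothesis op_mono : forall x x' y y', R x x' -> R y y' -> R (op x y) (op x' y').
Hypothesis R_trans : forall y x z, R x y -> R y z -> R x z.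

Lemma fold_set_lub g F (F0 : F !=set0) z : finite_set F ->
  R (fold_set op g F0) z <-> forall a, F a -> R (g a) z.
Proof.
move=> fF; rewrite /fold_set; case: (cid F0) => /= x0 Fx0.
have sF x : (x \in (fset_set F : seq X)) <-> F x.
  by rewrite (_ : (_ \in _) = (x \in fset_set F)) // in_fset_set // inE.
have foldE (s : seq X) : R (foldr (fun a => op (g a)) (g x0) s) z <->
    R (g x0) z /\ forall a, a \in s -> R (g a) z.
  elim: s => [|b s IH] /=; first by split=> [|[]].
  split=> [H|[H0 H]].
    have [H1 H2] : R (g x0) z /\ forall a, a \in s -> R (g a) z.
      by apply/IH; apply: R_trans H; rewrite opC; exact: opR.
    split=> // a; rewrite inE => /predU1P[->|/H2//].
    by apply: R_trans H; exact: opR.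
  rewrite -(opxx z); apply: op_mono; first by apply: H; rewrite mem_head.
  by apply/IH; split=> // a sa; apply: H; rewrite inE sa orbT.
split=> [/foldE[_ H] a /sF/H//|H].
by apply/foldE; split=> [|a /sF]; exact: H.
Qed.

End Fold.

Lemma directed_semilattice_mono op (x x' y y' : Y) :
  directed_semilattice op -> spec_le x x' -> spec_le y y' ->
  spec_le (op x y) (op x' y').
Proof.
move=> opd xx' yy'; apply/spec_leP => U Uo Uxy.
have /(_ U Uo) Vo := iffLR (continuousP _) (dsl_continuous opd).
exact: (conv_open_up (@tensor_le_refl Y Y) (@tensor_converges1 Y Y)
  (x := (x, y)) (y := (x', y')) Vo (conj xx' yy') Uxy).
Qed.

Lemma lower_ext_fin join g F (fF : finite_set F) (F0 : F !=set0) :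
  vee_directed join -> continuous g ->
  lower_ext join g (lower_fin fF F0) = fold_set join g F0.
Proof.
move=> [jd jle] gc; rewrite /lower_ext.
case: (cid _) => G [fG G0 FG].
have lub := fold_set_lub (dsl_idempotent jd) jle (dsl_commutative jd)
  (fun x x' y y' => @directed_semilattice_mono join x x' y y' jd)
  spec_le_trans.
have sub (A B : set X) (A0 : A !=set0) (B0 : B !=set0) :
    finite_set A -> finite_set B -> downset A = downset B ->
    spec_le (fold_set join g A0) (fold_set join g B0).
  move=> fA fB AB; apply/lub => // a /downsetS; rewrite AB => -[b Bb ab].
  apply: (spec_le_trans (continuous_spec_le gc ab)).
  by move: b Bb {ab}; apply/lub => //; exact: spec_le_refl.
by apply: (spec_le_anti (dsl_space jd).1); apply: sub.
Qed.

Lemma upper_ext_fin meet g F (fF : finite_set F) (F0 : F !=set0) :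
  wedge_directed meet -> continuous g ->
  upper_ext meet g (upper_fin fF F0) = fold_set meet g F0.
Proof.
move=> [md mle] gc; rewrite /upper_ext.
case: (cid _) => G [fG G0 FG].
pose ge (x y : Y) := spec_le y x.
have ge_trans (y x z : Y) : ge x y -> ge y z -> ge x z.
  by move=> xy yz; exact: spec_le_trans yz xy.
have glb := fold_set_lub (R := ge) (dsl_idempotent md) mle (dsl_commutative md)
  (fun x x' y y' => @directed_semilattice_mono meet x' x y' y md)
  ge_trans.
have sub (A B : set X) (A0 : A !=set0) (B0 : B !=set0) :
    finite_set A -> finite_set B -> upset A = upset B ->
    ge (fold_set meet g A0) (fold_set meet g B0).
  move=> fA fB AB; apply/glb => // a /upsetS; rewrite AB => -[b Bb ab].
  apply: ge_trans (_ : ge (g a) (g b)) _; first exact: continuous_spec_le.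
  by move: b Bb {ab}; apply/glb => //; exact: spec_le_refl.
by apply: (spec_le_anti (dsl_space md).1); apply: sub.
Qed.

End Extension.

(* Main.v *)
Require Import Defs.
From mathcomp Require Import all_boot.
From mathcomp Require Import boolp classical_sets functions cardinality.
From mathcomp Require Import filter topology.

Set Implicit Arguments.
Unset Strict Implicit.
Unset Printing Implicit Defensive.

Local Open Scope classical_set_scope.

(** Both powerspaces of a directed space [X] fit one pattern: a semilattice
    [S] with an operation [op] (union of sets in both cases) and a map [eta]
    from [X], generated by the image of [eta] under [op], and with the following
    description of the topology: [V] is open iff it is an upper set for the
    specialization order and, for every [K] in [S], the set of the [x] with
    [V (op K (eta x))] is open in [X].  In other words, convergence in [S] is
    generated by moving one generator at a time ([lower_openP],
    [upper_openP]); the record [semilattice_over] collects this.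

    Everything about continuity follows from that description.  The
    translations [op K] are continuous because [op] is associative, and on a
    directed space a commutative operation is continuous for the tensor
    topology as soon as its translations are continuous, because a directed
    set of pairs is eventually above any two of its components.  A monotone
    map [F] that preserves [op] is continuous as soon as [F \o eta] is, since
    [F (op K (eta x))] is the image of [F (eta x)] under a translation.  This
    applies to the extensions P_L(g) and P_U(g).

    If [Z] has binary infima, [P_L(Z)] has binary infima too: the intersection
    of two finitely generated lower sets is generated by the pairwise infima
    of their generators.  Intersection distributes over union, so for fixed
    [B] the map sending [A] to the intersection of [A] and [B] preserves [op],
    and its continuity is again a question about generators
    ([so_second_directed_semilattice]).  Dually, [P_U(Z)] has binary suprema,
    given by intersection, when [Z] has them.  So [P_L(P_U(X))] and
    [P_U(P_L(X))] are distributive lattices.  An extension along [eta] of a map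
    that preserves the second operation preserves it too, because both sides
    distribute ([so_morphism_second]); that gives the lattice morphism
    extending [f], and induction over the generators, once for each
    powerspace, gives uniqueness.  The isomorphism is the usual comparison of
    two free objects. *)

(** * Directed sets and convergence *)

Lemma finite_set_nonempty_ind (T : choiceType) (P : set T -> Prop) :
  (forall x, P [set x]) -> (forall A B, P A -> P B -> P (A `|` B)) ->
  forall F, finite_set F -> F !=set0 -> P F.
Proof.
move=> P1 PU F /finite_seqP[s ->] [x /= xs].
have -> : [set` s] = [set x] `|` [set` s].
  by apply/seteqP; split=> y /=; [right|case=> [->|]].
elim: s {xs} => [|y s IH].
  by rewrite (_ : [set` [::]] = set0) ?setU0 //; apply/seteqP; split.
rewrite (_ : [set` y :: s] = [set y] `|` [set` s]).
  by rewrite setUCA; exact: PU.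
by apply/seteqP; split=> z /=; rewrite inE => /predU1P.
Qed.

(** Upper bounds of pairs suffice, as usual; this form is easier to establish
    for images and products of directed sets. *)
Lemma directed_subsetP (T : choiceType) (le : T -> T -> Prop) (D : set T) :
  (forall x, le x x) -> (forall y x z, le x y -> le y z -> le x z) ->
  directed_subset le D <->
  D !=set0 /\ forall x y, D x -> D y -> exists z, [/\ D z, le x z & le y z].
Proof.
move=> le_refl le_trans.
split=> -[D0 Dd]; split=> //.
  move=> x y Dx Dy; have [|||z Dz zP] := Dd [set x; y].
  - by move=> _ [->|->].
  - exact: finite_set2.
  - by exists x; left.
  by exists z; split=> //; apply: zP; [left|right].
suff H A : finite_set A -> A !=set0 -> A `<=` D ->
    exists2 z, D z & forall a, A a -> le a z by move=> A AD fA A0; exact: H.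
move: A; apply: finite_set_nonempty_ind => [x|A B IA IB] sD.
  by exists x; [exact: sD|move=> _ ->].
have [|a Da aP] := IA; first by move=> x Ax; apply: sD; left.
have [|b Db bP] := IB; first by move=> x Ax; apply: sD; right.
have [z [Dz az bz]] := Dd _ _ Da Db; exists z => // x [/aP xa|/bP xb].
  exact: le_trans az.
exact: le_trans bz.
Qed.

Lemma directed_subset_image (T U : choiceType) (leT : T -> T -> Prop)
    (leU : U -> U -> Prop) (f : T -> U) (D : set T) :
  (forall x, leT x x) -> (forall y x z, leT x y -> leT y z -> leT x z) ->
  (forall x, leU x x) -> (forall y x z, leU x y -> leU y z -> leU x z) ->
  (forall x y, leT x y -> leU (f x) (f y)) ->
  directed_subset leT D -> directed_subset leU (f @` D).
Proof.
move=> rT tT rU tU fle /(directed_subsetP D rT tT)[[d Dd] DD].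
apply/directed_subsetP => //; split; first by exists (f d), d.
move=> _ _ [x Dx <-] [y Dy <-]; have [z [Dz xz yz]] := DD _ _ Dx Dy.
by exists (f z); split; [exists z|exact: fle|exact: fle].
Qed.

Section Directed.
Context {X : topologicalType}.
Implicit Types (x y : X) (D U : set X).

Lemma directed_ub D x y : directed_subset spec_le D -> D x -> D y ->
  exists z, [/\ D z, spec_le x z & spec_le y z].
Proof.
move=> /(directed_subsetP D (@spec_le_refl X) (@spec_le_trans X))[_ H].
exact: H.
Qed.

Lemma open_up U x y : open U -> spec_le x y -> U x -> U y.
Proof. by move=> Uo /spec_leP; exact. Qed.

(** Open sets are upper sets, so for directed sets meeting every open
    neighbourhood is the same as being eventually in it. *)
Lemma convergesP D x :
  converges D x <->
  forall U, open U -> U x -> exists2 d, D d & U d.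
Proof.
split=> [Dx U Uo Ux|Dx U Uo Ux].
  have [d Dd dP] := Dx U Uo Ux; exists d => //.
  by apply: dP => //; exact: spec_le_refl.
have [d Dd Ud] := Dx U Uo Ux; exists d => // e _ de; exact: open_up Ud.
Qed.

Lemma converges_le D x y : converges D y -> spec_le x y -> converges D x.
Proof.
move=> /convergesP Dy xy; apply/convergesP => U Uo Ux.
by apply: Dy => //; exact: open_up Ux.
Qed.

Lemma open_directed_open U : open U -> directed_open U.
Proof.
by move=> Uo D x _ /convergesP Dx Ux; have [d ? ?] := Dx _ Uo Ux; exists d.
Qed.

(** Antisymmetry of the specialization order is the T0 axiom. *)
Lemma spec_le_kolmogorov :
  (forall x y, spec_le x y -> spec_le y x -> x = y) -> kolmogorov_space X.
Proof.
move=> anti x y xy.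
have sep (u v : X) : ~ spec_le u v ->
    exists A : set X, A \in nbhs u /\ v \in ~` A.
  move=> /spec_leP uv; apply: contrapT => nA; apply: uv => U Uo Uu.
  apply: contrapT => nUv; apply: nA; exists U; rewrite !inE; split=> //.
  exact: open_nbhs_nbhs.
have [le|/sep[A ?]] := pselect (spec_le x y); last by exists A; left.
have [ge|/sep[A ?]] := pselect (spec_le y x); last by exists A; right.
by move: xy; rewrite (anti _ _ le ge) eqxx.
Qed.

End Directed.

Lemma converges_image (X Y : topologicalType) (f : X -> Y) D x :
  continuous f -> converges D x -> converges (f @` D) (f x).
Proof.
move=> /continuousP fc /convergesP Dx; apply/convergesP => U Uo Ux.
by have [d Dd Ud] := Dx _ (fc _ Uo) Ux; exists (f d) => //; exists d.
Qed.

Lemma directed_image (X Y : topologicalType) (f : X -> Y) D :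
  continuous f -> directed_subset spec_le D -> directed_subset spec_le (f @` D).
Proof.
move=> fc; apply: directed_subset_image; do ?exact: spec_le_refl.
- exact: spec_le_trans.
- exact: spec_le_trans.
by move=> x y; exact: continuous_spec_le.
Qed.

Lemma directed_open_open (X : topologicalType) (U : set X) :
  directed_space X ->
  (forall D x, directed_subset spec_le D -> converges D x -> U x ->
     exists2 d, D d & U d) -> open U.
Proof.
move=> [_ Xd] H; apply/Xd => D x dD Dx Ux.
by have [d ? ?] := H _ _ dD Dx Ux; exists d.
Qed.

(** * Operations on directed spaces *)

Section TensorOperation.
Variable X : topologicalType.

(** If [V (op x y)] and the projections of [D] converge to [x] and [y], then
    moving [x] and [y] one after the other gives two elements of [D] whose
    respective components are sent into [V]; an upper bound of the two in [D]
    does it too, because [op] is monotone. *)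
Lemma tensor_continuous (op : X -> X -> X) :
  commutative op -> (forall K, continuous (op K)) ->
  continuous (fun p : tensor X X => op p.1 p.2).
Proof.
move=> opC opc; apply/continuousP => V Vo.
suff: tensor_open [set p : tensor X X | V (op p.1 p.2)] by [].
move=> D [x y] dD [/= /convergesP Dx /convergesP Dy] Vxy.
have O K : open [set z | V (op K z)] by move/continuousP: (opc K); exact.
have [|_ [q1 Dq1 <-] Vq1] := Dx _ (O y); first by rewrite /= opC.
have [|_ [q2 Dq2 <-] Vq2] := Dy _ (O q1.1); first by rewrite /= opC.
have [|||q Dq qP] := dD.2 [set q1; q2].
- by move=> _ [->|->].
- exact: finite_set2.
- by exists q1; left.
have [[le1 _] [_ le2]] := (qP _ (or_introl erefl), qP _ (or_intror erefl)).
exists q; split=> //=.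
apply: (open_up Vo (continuous_spec_le (opc _) le2)).
rewrite opC; apply: (open_up Vo (continuous_spec_le (opc _) le1)).
by rewrite opC.
Qed.

(** A directed set converging to [x], paired with the constant [K], is a
    directed set converging to [(K, x)] in the tensor product. *)
Lemma translation_continuous (op : X -> X -> X) K :
  directed_semilattice op -> continuous (op K).
Proof.
move=> opd; apply/continuousP => V Vo; have Xd := dsl_space opd.
have /continuousP/(_ _ Vo) Wo := dsl_continuous opd.
apply: directed_open_open => // D x dD Dx Vx.
have [||_ [[d Dd <-] Vd]] :=
    Wo ((fun d => (K, d) : tensor X X) @` D) (K, x) _ _ Vx; last by exists d.
  apply: directed_subset_image dD; do ?exact: spec_le_refl.
  - exact: spec_le_trans.
  - by move=> ?; exact: tensor_le_refl.
  - by move=> q p r [? ?] [? ?]; split; apply: spec_le_trans; eassumption.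
  by move=> y z yz; split=> //; exact: spec_le_refl.
have [[e De] _] := dD.
split=> /=; rewrite image_comp.
  rewrite (_ : _ @` D = [set K]).
    by apply: converges1; exact: spec_le_refl.
  by apply/seteqP; split=> [_ [? _ <-]|_ ->] //; exists e.
rewrite (_ : _ @` D = D) //.
by apply/seteqP; split=> [_ [? ? <-]|d Dd] //; exists d.
Qed.

End TensorOperation.

(** The pairing of [f] and [g] need not be discussed as a map into the tensor
    product: along a directed set the two arguments can be moved one after the
    other, and joined again by an upper bound. *)
Lemma op_continuous (X Y : topologicalType) (op : Y -> Y -> Y) (f g : X -> Y) :
  directed_space X -> directed_semilattice op -> continuous f -> continuous g ->
  continuous (fun x => op (f x) (g x)).
Proof.
move=> Xd opd fc gc; apply/continuousP => V Vo.
have O h K : continuous h -> open [set x : X | V (op K (h x))].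
  move=> /continuousP hc; apply: (hc [set y | V (op K y)]).
  by move/continuousP: (@translation_continuous _ _ K opd); exact.
apply: directed_open_open => // D x dD /convergesP Dx Vx.
have [|d Dd Vd] := Dx _ (O _ (f x) gc); first by [].
have [|e De Ve] := Dx _ (O _ (g d) fc);
  first by rewrite /= (dsl_commutative opd).
have [z [Dz dz ez]] := directed_ub dD Dd De; exists z => //.
rewrite /= (dsl_commutative opd); apply: (open_up Vo _ Ve).
by apply: directed_semilattice_mono => //; exact: continuous_spec_le.
Qed.

(** * Semilattices generated by a directed space *)

(** The common description of [P_L(X)] and [P_U(X)].  The field [so_open]
    says that [S] carries the finest topology for which open sets are upper
    sets and all the maps sending [x] to [op K (eta x)] are continuous.  It
    mentions the specialization order of [S] itself, so it is meant to be used
    together with a concrete description of that order. *)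
Record semilattice_over (X S : topologicalType) (op : S -> S -> S)
    (eta : X -> S) : Prop := {
  so_idempotent : idempotent_op op;
  so_associative : associative op;
  so_commutative : commutative op;
  so_kolmogorov : kolmogorov_space S;
  so_le : forall K A B, spec_le A B -> spec_le (op K A) (op K B);
  so_ind : forall P : S -> Prop, (forall x, P (eta x)) ->
    (forall A B, P A -> P B -> P (op A B)) -> forall A, P A;
  so_open : forall V, open V <->
    (forall A B, spec_le A B -> V A -> V B) /\
    forall K, open [set x | V (op K (eta x))] }.

Section SemilatticeOver.
Variables (X S : topologicalType) (op : S -> S -> S) (eta : X -> S).
Hypothesis Xd : directed_space X.
Hypothesis So : semilattice_over op eta.
Let opC := so_commutative So.

Lemma so_translation_continuous K : continuous (op K).
Proof.
apply/continuousP => V Vo; have [Vup VK] := (so_open So V).1 Vo.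
apply/(so_open So); split=> [A B AB|K'].
  exact: Vup _ _ (so_le So AB).
rewrite (_ : [set _ | _] = [set x | V (op (op K K') (eta x))]); first exact: VK.
by apply/funext => x; rewrite /= (so_associative So).
Qed.

Lemma so_translation_eta_continuous K : continuous (fun x => op K (eta x)).
Proof. by apply/continuousP => V /(so_open So)[_]; exact. Qed.

(** The field [so_open] speaks of [op K (eta x)] only.  The point [eta x] is
    [op (eta x) (eta x)], and moving the two copies of [x] in turn along a
    directed set gives [op (eta d) (eta e)], which is below
    [op (eta z) (eta z) = eta z] for an upper bound [z] of [d] and [e]. *)
Lemma so_eta_continuous : continuous eta.
Proof.
have mono K x y : spec_le x y -> spec_le (op K (eta x)) (op K (eta y)).
  exact: continuous_spec_le (@so_translation_eta_continuous K).
apply/continuousP => V Vo; have [Vup VK] := (so_open So V).1 Vo.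
apply: directed_open_open => // D x dD /convergesP Dx Vx.
have [|d Dd Vd] := Dx _ (VK (eta x)); first by rewrite /= (so_idempotent So).
have [|e De Ve] := Dx _ (VK (eta d)); first by rewrite /= opC.
have [z [Dz dz ez]] := directed_ub dD Dd De; exists z => //.
rewrite /= -[eta z](so_idempotent So).
apply: (Vup _ _ (mono _ _ _ dz)); rewrite opC.
exact: Vup _ _ (mono _ _ _ ez) _.
Qed.

(** Openness in [S] is tested along the maps sending [x] to [op K (eta x)],
    which carry directed convergent sets of [X] to such sets of [S]. *)
Lemma so_directed_space : directed_space S.
Proof.
split; first exact: so_kolmogorov So.
move=> U; split; last exact: open_directed_open.
move=> Uo; apply/(so_open So); split=> [A B|K].
  exact: conv_open_up (@spec_le_refl _) (@converges1 _) _ _ _ Uo.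
have fc := @so_translation_eta_continuous K.
apply: directed_open_open => // D x dD Dx Ux.
have [_ [[d Dd <-] Ud]] :=
  Uo _ _ (directed_image fc dD) (converges_image fc Dx) Ux.
by exists d.
Qed.

Lemma so_directed_semilattice : directed_semilattice op.
Proof.
split.
- exact: so_directed_space.
- exact: tensor_continuous opC so_translation_continuous.
- exact: so_idempotent So.
- exact: so_associative So.
- exact: so_commutative So.
Qed.

Section Extension.
Variables (Y : topologicalType) (opY : Y -> Y -> Y) (F : S -> Y).
Hypothesis FM : {morph F : A B / op A B >-> opY A B}.

(** The test for openness of the preimage of [V] at [K] is the preimage of
    [V] under [F \o eta] followed by the translation by [F K]. *)
Lemma so_morphism_continuous :
  directed_semilattice opY ->
  (forall A B, spec_le A B -> spec_le (F A) (F B)) ->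
  continuous (F \o eta) -> continuous F.
Proof.
move=> Yd Fle /continuousP fc; apply/continuousP => V Vo.
apply/(so_open So); split=> [A B /Fle|K].
  exact: open_up.
rewrite (_ : [set _ | _] = (F \o eta) @^-1` [set y | V (opY (F K) y)]).
  apply: fc; move/continuousP: (@translation_continuous _ _ (F K) Yd); exact.
by apply/funext => x; rewrite /= FM.
Qed.

Lemma so_morphism_unique (G : S -> Y) :
  {morph G : A B / op A B >-> opY A B} -> F \o eta =1 G \o eta -> F = G.
Proof.
move=> GM FG; apply/funext; apply: (so_ind So) => [x|A B FA FB].
  exact: FG.
by rewrite FM GM FA FB.
Qed.

(** Distributivity on both sides reduces the claim, by induction on one
    argument and then the other, to the generators. *)
Lemma so_morphism_second op' opY' :
  commutative op' -> commutative opY' ->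
  left_distributive op' op -> left_distributive opY' opY ->
  (forall x y, F (op' (eta x) (eta y)) = opY' (F (eta x)) (F (eta y))) ->
  {morph F : A B / op' A B >-> opY' A B}.
Proof.
move=> C' CY' D' DY' FE A B; elim/(so_ind So): A => [x|A1 A2 IA1 IA2].
  elim/(so_ind So): B => [y|B1 B2 IB1 IB2]; first exact: FE.
  by rewrite C' D' FM FM CY' DY' !(C' _ (eta x)) IB1 IB2 !(CY' (F (eta x))).
by rewrite D' !FM DY' IA1 IA2.
Qed.

End Extension.

(** A second operation [op'] that extends the one of [X] and distributes over
    [op] is continuous: each translation [op' B] preserves [op], so only
    [op' B \o eta] matters.  By induction on [B] this is continuous, being
    [eta \o opX b] when [B] is a generator [eta b], and a pointwise [op] of
    continuous maps when [B] is composite. *)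
Lemma so_second_directed_semilattice (opX : X -> X -> X) op' :
  directed_semilattice opX ->
  idempotent_op op' -> associative op' -> commutative op' ->
  left_distributive op' op ->
  (forall C A B, spec_le A B -> spec_le (op' C A) (op' C B)) ->
  {morph eta : x y / opX x y >-> op' x y} ->
  directed_semilattice op'.
Proof.
move=> Xo I' A' C' D' mono etaM; have Sd := so_directed_semilattice.
split=> //; first exact: so_directed_space.
apply: tensor_continuous => // B.
apply: (@so_morphism_continuous _ op) => //.
- by move=> A1 A2; rewrite C' D' !(C' B).
- by move=> A1 A2; exact: mono.
elim/(so_ind So): B => [b|B1 B2 IB1 IB2].
  rewrite (_ : _ \o _ = eta \o opX b); last first.
    by apply/funext => x /=; rewrite etaM.
  move=> x; apply: continuous_comp; first exact: translation_continuous.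
  exact: so_eta_continuous.
rewrite (_ : _ \o _ = fun x => op ((op' B1 \o eta) x) ((op' B2 \o eta) x)).
  exact: op_continuous.
by apply/funext => x /=; rewrite D'.
Qed.

End SemilatticeOver.

(** * The lower powerspace *)

Section Lower.
Variable X : topologicalType.
Local Notation LX := (lower_powerspace X).
Implicit Types A B : LX.

Lemma lower_eq A B : A = B :> set X -> A = B.
Proof.
case: A B => A AP [B BP] /= AB; move: AP BP; rewrite AB => AP BP.
by congr LowerPowerspace; exact: Prop_irrelevance.
Qed.

Lemma lower_down A x y : lower_set A y -> spec_le x y -> lower_set A x.
Proof. by have [F [_ _ ->]] := lower_setP A; exact: downset_le. Qed.

Lemma lower_ind (P : LX -> Prop) : (forall x, P (eta_vee x)) ->
  (forall A B, P A -> P B -> P (lower_join A B)) -> forall A, P A.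
Proof.
move=> P1 PU A; have [F [fF F0 AF]] := lower_setP A.
rewrite (_ : A = lower_fin fF F0); last exact: lower_eq.
suff H : forall G, finite_set G -> G !=set0 ->
    exists2 B : LX, B = downset G :> set X & P B.
  have [B BF] := H _ fF F0.
  by rewrite (_ : B = lower_fin fF F0) //; exact: lower_eq.
apply: finite_set_nonempty_ind => [x|G H [B BG PB] [C CH PC]].
  by exists (eta_vee x).
by exists (lower_join B C); [rewrite /= BG CH downsetU|exact: PU].
Qed.

Lemma eta_veeE (x : X) y : lower_set (eta_vee x) y <-> spec_le y x.
Proof. by split=> [[_ ->]|]; [|exists x]. Qed.

(** The downset of a point is its closure. *)
Lemma lower_closed A : closed A.
Proof.
move: A; apply: lower_ind => [x|A B]; last exact: closedU.
rewrite (_ : lower_set _ = closure [set x]); first exact: closed_closure.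
by apply/seteqP; split=> y; move/eta_veeE.
Qed.

(** When [A] is not included in [B], the sets not included in [B] form an
    open neighbourhood of [A] that misses [B]: a convergent [D] has a directed
    set of points in its union that tends to a point outside the closed set
    [B]. *)
Lemma lower_leP A B : spec_le A B <-> A `<=` B.
Proof.
split=> [/spec_leP AB|AB]; last first.
  apply/spec_leP => U Uo.
  exact: (conv_open_up (@lower_le_refl X) (@lower_converges1 X) Uo).
apply: contrapT => nAB.
have /AB : open [set C : LX | ~ C `<=` B].
  suff: lower_open [set C : LX | ~ C `<=` B] by [].
  move=> D C _ [F [_ _ CF FD]] nCB.
  have [a Fa nBa] : exists2 a, F a & ~ lower_set B a.
    apply: contrapT => H; apply: nCB => x; rewrite CF => -[a Fa].
    apply: lower_down; apply: contrapT => nBa; by apply: H; exists a.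
  have [Da [_ DaD /convergesP Daa]] := FD _ Fa.
  have [d /DaD[E DE Ed] nBd] := Daa _ (closed_openC (@lower_closed B)) nBa.
  by exists E; split=> // /(_ _ Ed).
by move=> /(_ nAB); apply.
Qed.

(** For the converse direction, let [D] converge to [A].  Induction on [A]
    replaces the generators of [A] one at a time by points of the union of
    [D], the rest of the set being the translation [K], and so gives
    [V (lower_join K C)] for some [C] in [D].  There is no empty [K] to start
    from; starting at [A] itself and then doing it once more, with the member
    of [D] just found as [K], removes what is left of [A]. *)
Lemma lower_openP (V : set LX) : directed_space X ->
  open V <-> (forall A B, spec_le A B -> V A -> V B) /\
             forall K, open [set x | V (lower_join K (eta_vee x))].
Proof.
move=> Xd; split=> [Vo|[Vup VK]].
  split=> [A B|K]; first exact: open_up.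
  apply: directed_open_open => // D x dD Dx Vx.
  have [||_ [[d Dd <-] Vd]] := (Vo : lower_open V)
    ((fun d => lower_join K (eta_vee d)) @` D) _ _ _ Vx; last by exists d.
    apply: directed_subset_image dD; do ?exact: spec_le_refl.
    - exact: spec_le_trans.
    - exact: lower_le_refl.
    - by move=> B A C AB BC; exact: subset_trans BC.
    move=> y z yz; apply: setUS => w /eta_veeE wy.
    exact/eta_veeE/(spec_le_trans wy).
  have [[e De] _] := dD.
  have [F [fF F0 FE]] := lower_setP (lower_join K (eta_vee x)).
  exists F; split=> // a Fa.
  have : lower_set (lower_join K (eta_vee x)) a by rewrite FE; exact: downsetS.
  case=> [Ka|/eta_veeE ax]; last first.
    exists D; split=> //; last exact: converges_le ax.
    move=> d Dd; exists (lower_join K (eta_vee d)); first by exists d.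
    by right; apply/eta_veeE; exact: spec_le_refl.
  exists [set a]; split.
  - by apply: directed_subset1; exact: spec_le_refl.
  - by move=> _ ->; exists (lower_join K (eta_vee e)); [exists e|left].
  - by apply: converges1; exact: spec_le_refl.
suff: lower_open V by [].
move=> D A dD [F [fF F0 AF FD]] VA.
(* Every point of [A], not only its generators, is a limit of points of
   members of [D]: the hypothesis thus passes to the two parts of a join. *)
have AD a : lower_set A a ->
    exists Da, Da `<=` \bigcup_(B in D) B /\ converges Da a.
  rewrite AF => -[b Fb ab]; have [Da [_ ? ?]] := FD _ Fb.
  by exists Da; split=> //; exact: converges_le ab.
have subV (B C : LX) : B `<=` C -> V B -> V C by move/lower_leP; exact: Vup.
have [_ ub] := (directed_subsetP D (@lower_le_refl X)
  (fun _ _ _ BC CE => subset_trans BC CE)).1 dD.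
suff H K : V (lower_join K A) -> exists2 C, D C & V (lower_join K C).
  have [|C1 D1 V1] := H A; first by apply: subV VA => x; left.
  have [|C2 D2 V2] := H C1; first by apply: subV V1 => x [|]; [right|left].
  have [C [DC C1C C2C]] := ub _ _ D1 D2.
  by exists C; split=> //; apply: subV V2; rewrite subUset.
elim/lower_ind: A {F fF F0 AF FD VA} AD K => [a|A B IA IB] AD K VK'.
  have [|Da [DaD /convergesP Daa]] := AD a.
    by apply/eta_veeE/spec_le_refl.
  have [d /DaD[C DC Cd] Vd] := Daa _ (VK K) VK'; exists C => //.
  apply: subV Vd; apply: setUS => x /eta_veeE; exact: lower_down.
have [|C1 D1 V1] := IA (fun a Aa => AD a (or_introl Aa)) (lower_join K B).
  by apply: subV VK' => x [|[|]]; [left; left|right|left; right].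
have [|C2 D2 V2] := IB (fun a Ba => AD a (or_intror Ba)) (lower_join K C1).
  by apply: subV V1 => x [[|]|]; [left; left|right|left; right].
have [C [DC C1C C2C]] := ub _ _ D1 D2.
exists C => //; apply: subV V2 => x [[|/C1C]|/C2C]; by [left|right].
Qed.

Lemma lower_semilattice_over : directed_space X ->
  semilattice_over (@lower_join X) (@eta_vee X).
Proof.
move=> Xd; split.
- by move=> A; apply: lower_eq; exact: setUid.
- by move=> A B C; apply: lower_eq; exact: setUA.
- by move=> A B; apply: lower_eq; exact: setUC.
- by apply: spec_le_kolmogorov => A B /lower_leP AB /lower_leP BA;
    apply: lower_eq; apply/seteqP.
- by move=> K A B /lower_leP AB; apply/lower_leP; exact: setUS.
- exact: lower_ind.
- by move=> V; exact: lower_openP.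
Qed.

End Lower.

(** * The upper powerspace *)

Section Upper.
Variable X : topologicalType.
Local Notation UX := (upper_powerspace X).
Implicit Types A B : UX.

Lemma upper_eq A B : A = B :> set X -> A = B.
Proof.
case: A B => A AP [B BP] /= AB; move: AP BP; rewrite AB => AP BP.
by congr UpperPowerspace; exact: Prop_irrelevance.
Qed.

Lemma upper_up A x y : upper_set A x -> spec_le x y -> upper_set A y.
Proof. by have [F [_ _ ->]] := upper_setP A; exact: upset_le. Qed.

Lemma upper_ind (P : UX -> Prop) : (forall x, P (eta_wedge x)) ->
  (forall A B, P A -> P B -> P (upper_meet A B)) -> forall A, P A.
Proof.
move=> P1 PU A; have [F [fF F0 AF]] := upper_setP A.
rewrite (_ : A = upper_fin fF F0); last exact: upper_eq.
suff H : forall G, finite_set G -> G !=set0 ->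
    exists2 B : UX, B = upset G :> set X & P B.
  have [B BF] := H _ fF F0.
  by rewrite (_ : B = upper_fin fF F0) //; exact: upper_eq.
apply: finite_set_nonempty_ind => [x|G H [B BG PB] [C CH PC]].
  by exists (eta_wedge x).
by exists (upper_meet B C); [rewrite /= BG CH upsetU|exact: PU].
Qed.

Lemma eta_wedgeE (x : X) y : upper_set (eta_wedge x) y <-> spec_le x y.
Proof. by split=> [[_ ->]|]; [|exists x]. Qed.

(** When [b] is in [B] and not in [A], the complement [U] of the closure of
    [b] contains [A], and the sets included in [U] form an open neighbourhood
    of [A] that misses [B]. *)
Lemma upper_leP A B : spec_le A B <-> B `<=` A.
Proof.
split=> [/spec_leP AB|AB]; last first.
  apply/spec_leP => U Uo.
  exact: (conv_open_up (@upper_le_refl X) (@upper_converges1 X) Uo).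
move=> b Bb; apply: contrapT => nAb.
pose U := ~` closure [set b].
have Uo : open U by exact/closed_openC/closed_closure.
have /AB : open [set C : UX | C `<=` U].
  suff: upper_open [set C : UX | C `<=` U] by [].
  move=> D C _ [F [_ _ CF [n [Ds [_ Fl _ DsD]]]]] CU.
  have H i : exists d, Ds i d /\ U d.
    have [a [Fa /convergesP Da]] := Fl i.
    have [|d Dd Ud] := Da _ Uo; last by exists d.
    by apply: CU; rewrite CF; exact: upsetS.
  have /choice[d dP] := H.
  have [|E DE EU] := DsD d; first by move=> i; have [] := dP i.
  exists E; split=> // x /EU[i _ [_ -> dx]].
  by apply: open_up Uo dx _; have [] := dP i.
have AU : A `<=` U by move=> x Ax xb; apply: nAb; exact: upper_up xb.
move=> /(_ AU)/(_ _ Bb); apply; exact: spec_le_refl.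
Qed.

(** For the converse direction, let [D] converge to [A] with directed sets
    [Ds i].  Each [Ds i] has a limit in [A], so starting from [K = A] one can
    add, for each [i] in turn, the upset of some [d i] in [Ds i] and keep [K]
    in [V].  Some member of [D] is included in the union of the upsets of the
    [d i], hence in [K], and so is above [K] in the order of the powerspace. *)
Lemma upper_openP (V : set UX) : directed_space X ->
  open V <-> (forall A B, spec_le A B -> V A -> V B) /\
             forall K, open [set x | V (upper_meet K (eta_wedge x))].
Proof.
move=> Xd; split=> [Vo|[Vup VK]].
  split=> [A B|K]; first exact: open_up.
  apply: directed_open_open => // D x dD Dx Vx.
  have [||_ [[d Dd <-] Vd]] := (Vo : upper_open V)
    ((fun d => upper_meet K (eta_wedge d)) @` D) _ _ _ Vx; last by exists d.
    apply: directed_subset_image dD; do ?exact: spec_le_refl.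
    - exact: spec_le_trans.
    - exact: upper_le_refl.
    - by move=> B A C AB BC; exact: subset_trans AB.
    move=> y z yz; apply: setUS => w /eta_wedgeE wy.
    exact/eta_wedgeE/(spec_le_trans yz).
  have [F [fF F0 KF [n [Ds [dDs FDs DsF DsK]]]]] :=
    upper_converges1 (@upper_le_refl _ K).
  (* Index [ord0] carries [D], with limit [x]; the other indices carry the
     constant directed sets that witness convergence of [K] to itself. *)
  exists (x |` F); split.
  - by rewrite finite_setU.
  - by exists x; left.
  - by rewrite upsetU setUC -KF.
  exists n.+1, (fun i => oapp Ds D (unlift ord0 i)); split.
  - by move=> i; case: unliftP => [j _|_] /=.
  - move=> i; case: unliftP => [j _|_]; last by exists x; split=> //; left.
    by have [a [Fa Da]] := FDs j; exists a; split=> //; right.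
  - move=> y [->|Fy]; first by exists ord0 => //; rewrite unlift_none.
    have [i _ Dy] := DsF _ Fy.
    by exists (lift ord0 i) => //; rewrite liftK.
  move=> d dP; exists (upper_meet K (eta_wedge (d ord0))).
    by exists (d ord0) => //; have := dP ord0; rewrite unlift_none.
  have [|_ -> Kd] := DsK (fun i => d (lift ord0 i)).
    by move=> i; have := dP (lift ord0 i); rewrite liftK.
  move=> y [/Kd[i _ iy]|/eta_wedgeE dy]; first by exists (lift ord0 i).
  by exists ord0 => //; exists (d ord0).
suff: upper_open V by [].
move=> D A dD [F [fF F0 AF [n [Ds [dDs FDs _ DsD]]]]] VA.
have subV (B C : UX) : C `<=` B -> V B -> V C by move/upper_leP; exact: Vup.
suff [d [K [dP KV Kd]]] : exists (d : 'I_n -> X) (K : UX),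
    [/\ forall i, Ds i (d i), V K & forall i, upper_set K (d i)].
  have [B DB BK] := DsD d dP; exists B; split=> //.
  by apply: subV KV => x /BK[i _ [_ ->]]; exact: upper_up.
suff [d [K [dP KV _ Kd]]] : exists (d : 'I_n -> X) (K : UX),
    [/\ forall i, Ds i (d i), V K, A `<=` K &
        forall i, i \in enum 'I_n -> upper_set K (d i)].
  by exists d, K; split=> // i; apply: Kd; rewrite mem_enum.
elim: (enum 'I_n) => [|j s [d [K [dP KV AK Kd]]]].
  have /choice[d dP] i : exists x, Ds i x by have [[x Dx] _] := dDs i; exists x.
  by exists d, A; split.
have [a [Fa /convergesP Da]] := FDs j.
have [|e De Ve] := Da _ (VK K).
  apply: subV KV => x [//|/eta_wedgeE]; apply: upper_up.
  by apply: AK; rewrite AF; exact: upsetS.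
exists (fun i => if i == j then e else d i), (upper_meet K (eta_wedge e)).
split=> //.
- by move=> i; case: eqP => [->|].
- by move=> x Ax; left; exact: AK.
move=> i; rewrite inE; case: eqP => [_ _|_ /Kd]; last by left.
by right; exact/eta_wedgeE/spec_le_refl.
Qed.

Lemma upper_semilattice_over : directed_space X ->
  semilattice_over (@upper_meet X) (@eta_wedge X).
Proof.
move=> Xd; split.
- by move=> A; apply: upper_eq; exact: setUid.
- by move=> A B C; apply: upper_eq; exact: setUA.
- by move=> A B; apply: upper_eq; exact: setUC.
- by apply: spec_le_kolmogorov => A B /upper_leP AB /upper_leP BA;
    apply: upper_eq; apply/seteqP.
- by move=> K A B /upper_leP AB; apply/upper_leP; exact: setUS.
- exact: upper_ind.
- by move=> V; exact: upper_openP.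
Qed.

End Upper.

(** * The lattice operations on the powerspaces *)

Section SpecializationLattice.
Variable Y : topologicalType.
Implicit Types (x y z : Y) (join meet : Y -> Y -> Y).

Lemma vee_directed_lub join x y z : vee_directed join ->
  spec_le (join x y) z <-> spec_le x z /\ spec_le y z.
Proof.
move=> [jd jle]; split=> [xyz|[xz yz]].
  split; apply: spec_le_trans xyz; first exact: jle.
  by rewrite (dsl_commutative jd); exact: jle.
by rewrite -[z](dsl_idempotent jd); exact: directed_semilattice_mono.
Qed.

Lemma wedge_directed_glb meet x y z : wedge_directed meet ->
  spec_le z (meet x y) <-> spec_le z x /\ spec_le z y.
Proof.
move=> [md mle]; split=> [xyz|[xz yz]].
  split; apply: (spec_le_trans xyz); first exact: mle.
  by rewrite (dsl_commutative md); exact: mle.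
by rewrite -[z](dsl_idempotent md); exact: directed_semilattice_mono.
Qed.

Lemma spec_le_eq_ub x y : kolmogorov_space Y ->
  (forall z, spec_le x z <-> spec_le y z) -> x = y.
Proof.
move=> Y0 xy; apply: (spec_le_anti Y0).
  by apply/xy; exact: spec_le_refl.
by apply/xy; exact: spec_le_refl.
Qed.

Lemma spec_le_eq_lb x y : kolmogorov_space Y ->
  (forall z, spec_le z x <-> spec_le z y) -> x = y.
Proof.
move=> Y0 xy; apply: (spec_le_anti Y0).
  by apply/xy; exact: spec_le_refl.
by apply/xy; exact: spec_le_refl.
Qed.

Lemma vee_wedge_meet_distr join meet : vee_wedge_directed join meet ->
  left_distributive meet join.
Proof.
move=> [_ [md _] D] x y z.
by rewrite (dsl_commutative md) D; congr join; exact: dsl_commutative md _ _.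
Qed.

(** In a lattice one distributive law implies the other. *)
Lemma vee_wedge_join_distr join meet : vee_wedge_directed join meet ->
  left_distributive join meet.
Proof.
move=> L x y z; have DD := vee_wedge_meet_distr L.
have [jv mw D] := L; have [[jd jle] [md mle]] := (jv, mw).
have jC := dsl_commutative jd.
have absorb a b : join (meet a b) a = a.
  apply: (spec_le_eq_ub (dsl_space jd).1) => c; split.
    by move=> /(vee_directed_lub _ _ _ jv)[].
  move=> ac; apply/(vee_directed_lub _ _ _ jv); split=> //.
  exact: spec_le_trans ac.
have absorb' a b : meet (join a b) b = b.
  apply: (spec_le_eq_lb (dsl_space jd).1) => c; split.
    by move=> /(wedge_directed_glb _ _ _ mw)[].
  move=> cb; apply/(wedge_directed_glb _ _ _ mw); split=> //.
  by apply: (spec_le_trans cb); rewrite jC; exact: jle.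
by rewrite D absorb' DD -(dsl_associative jd) absorb.
Qed.

End SpecializationLattice.

Section LowerLattice.
Variables (Z : topologicalType) (meet : Z -> Z -> Z).
Local Notation LZ := (lower_powerspace Z).

Lemma lower_vee_directed : directed_space Z -> vee_directed (@lower_join Z).
Proof.
move=> Zd; split.
  exact: so_directed_semilattice (lower_semilattice_over Zd).
by move=> A B; apply/lower_leP; exact: subsetUl.
Qed.

Hypothesis Zw : wedge_directed meet.
Let Zd : directed_space Z := dsl_space Zw.1.

(** A point is below some element of [F] and some element of [G] iff it is
    below one of the infima of such pairs. *)
Lemma lower_cap_subproof (A B : LZ) : exists F,
  [/\ finite_set F, F !=set0 & A `&` B = downset F].
Proof.
have [F [fF [x Fx] ->]] := lower_setP A.
have [G [fG [y Gy] ->]] := lower_setP B.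
exists [set meet a b | a in F & b in G]; split; first exact: finite_image2.
  by exists (meet x y), x => //; exists y.
apply/seteqP; split=> [z [[a Fa za] [b Gb zb]]|z [_ [a Fa [b Gb <-]]]].
  exists (meet a b); first by exists a => //; exists b.
  exact/(wedge_directed_glb _ _ _ Zw).
by move=> /(wedge_directed_glb _ _ _ Zw)[za zb]; split; [exists a|exists b].
Qed.

Definition lower_cap (A B : LZ) : LZ :=
  LowerPowerspace (lower_cap_subproof A B).

Lemma eta_vee_meet : {morph @eta_vee Z : x y / meet x y >-> lower_cap x y}.
Proof.
move=> x y; apply: lower_eq; apply/seteqP; split=> z.
  move=> /eta_veeE /(wedge_directed_glb _ _ _ Zw)[zx zy].
  by split; exact/eta_veeE.
move=> [/eta_veeE zx /eta_veeE zy].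
exact/eta_veeE/(wedge_directed_glb _ _ _ Zw).
Qed.

Lemma lower_cap_distr : left_distributive lower_cap (@lower_join Z).
Proof. by move=> A B C; apply: lower_eq; exact: setIUl. Qed.

Lemma lower_capC : commutative lower_cap.
Proof. by move=> A B; apply: lower_eq; exact: setIC. Qed.

Lemma lower_vee_wedge_directed : vee_wedge_directed (@lower_join Z) lower_cap.
Proof.
split; first exact: lower_vee_directed; last first.
  by move=> A B C; apply: lower_eq; exact: setIUr.
split; last by move=> A B; apply/lower_leP; exact: subIsetl.
apply: (so_second_directed_semilattice Zd (lower_semilattice_over Zd) Zw.1).
- by move=> A; apply: lower_eq; exact: setIid.
- by move=> A B C; apply: lower_eq; exact: setIA.
- exact: lower_capC.
- exact: lower_cap_distr.
- by move=> C A B /lower_leP AB; apply/lower_leP; exact: setIS.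
- exact: eta_vee_meet.
Qed.

End LowerLattice.

Section UpperLattice.
Variables (Z : topologicalType) (join : Z -> Z -> Z).
Local Notation UZ := (upper_powerspace Z).

Lemma upper_wedge_directed : directed_space Z -> wedge_directed (@upper_meet Z).
Proof.
move=> Zd; split.
  exact: so_directed_semilattice (upper_semilattice_over Zd).
by move=> A B; apply/upper_leP; exact: subsetUl.
Qed.

Hypothesis Zv : vee_directed join.
Let Zd : directed_space Z := dsl_space Zv.1.

(** Dually, being above an element of [F] and an element of [G] is being
    above a supremum of such a pair. *)
Lemma upper_cap_subproof (A B : UZ) : exists F,
  [/\ finite_set F, F !=set0 & A `&` B = upset F].
Proof.
have [F [fF [x Fx] ->]] := upper_setP A.
have [G [fG [y Gy] ->]] := upper_setP B.
exists [set join a b | a in F & b in G]; split; first exact: finite_image2.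
  by exists (join x y), x => //; exists y.
apply/seteqP; split=> [z [[a Fa za] [b Gb zb]]|z [_ [a Fa [b Gb <-]]]].
  exists (join a b); first by exists a => //; exists b.
  exact/(vee_directed_lub _ _ _ Zv).
by move=> /(vee_directed_lub _ _ _ Zv)[za zb]; split; [exists a|exists b].
Qed.

Definition upper_cap (A B : UZ) : UZ :=
  UpperPowerspace (upper_cap_subproof A B).

Lemma eta_wedge_join : {morph @eta_wedge Z : x y / join x y >-> upper_cap x y}.
Proof.
move=> x y; apply: upper_eq; apply/seteqP; split=> z.
  move=> /eta_wedgeE /(vee_directed_lub _ _ _ Zv)[zx zy].
  by split; exact/eta_wedgeE.
move=> [/eta_wedgeE zx /eta_wedgeE zy].
exact/eta_wedgeE/(vee_directed_lub _ _ _ Zv).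
Qed.

Lemma upper_cap_distr : left_distributive upper_cap (@upper_meet Z).
Proof. by move=> A B C; apply: upper_eq; exact: setIUl. Qed.

Lemma upper_capC : commutative upper_cap.
Proof. by move=> A B; apply: upper_eq; exact: setIC. Qed.

Lemma upper_vee_wedge_directed : vee_wedge_directed upper_cap (@upper_meet Z).
Proof.
split; last by move=> A B C; apply: upper_eq; exact: setUIr.
  split; last by move=> A B; apply/upper_leP; exact: subIsetl.
  apply: (so_second_directed_semilattice Zd (upper_semilattice_over Zd) Zv.1).
  - by move=> A; apply: upper_eq; exact: setIid.
  - by move=> A B C; apply: upper_eq; exact: setIA.
  - exact: upper_capC.
  - exact: upper_cap_distr.
  - by move=> C A B /upper_leP AB; apply/upper_leP; exact: setIS.
  - exact: eta_wedge_join.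
exact: upper_wedge_directed.
Qed.

End UpperLattice.

(** * Extensions to the powerspaces *)

Section LowerExtension.
Variables (X Y : topologicalType) (join : Y -> Y -> Y) (g : X -> Y).
Hypotheses (Xd : directed_space X) (Yv : vee_directed join) (gc : continuous g).
Local Notation F := (lower_ext join g).
Let Y0 : kolmogorov_space Y := (dsl_space Yv.1).1.

(** The supremum over a set of generators is the supremum over the whole lower
    set, since [g] is monotone; in this form the choice of generators has
    disappeared. *)
Lemma lower_ext_lub A z :
  spec_le (F A) z <-> forall a, lower_set A a -> spec_le (g a) z.
Proof.
have [G [fG G0 AG]] := lower_setP A.
rewrite (_ : A = lower_fin fG G0); last exact: lower_eq.
rewrite lower_ext_fin // (fold_set_lub (R := spec_le)) //.
- split=> H a; last by move=> Ga; apply: H; exact: downsetS.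
  by move=> [b /H + ab]; exact/spec_le_trans/continuous_spec_le.
- exact: dsl_idempotent Yv.1.
- by case: Yv.
- exact: dsl_commutative Yv.1.
- by move=> x x' y y'; exact: directed_semilattice_mono Yv.1.
- exact: spec_le_trans.
Qed.

Lemma lower_ext_join : {morph F : A B / lower_join A B >-> join A B}.
Proof.
move=> A B; apply: (spec_le_eq_ub Y0) => z.
rewrite lower_ext_lub (vee_directed_lub _ _ _ Yv) !lower_ext_lub.
split=> [H|[HA HB] a [/HA|/HB]//].
by split=> a Aa; apply: H; [left|right].
Qed.

Lemma lower_ext_eta : F \o @eta_vee X = g.
Proof.
apply/funext => x; apply: (spec_le_eq_ub Y0) => z /=; rewrite lower_ext_lub.
split=> [|gz a /eta_veeE ax]; first by apply; exact/eta_veeE/spec_le_refl.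
exact: spec_le_trans (continuous_spec_le gc ax) gz.
Qed.

Lemma lower_ext_continuous : continuous F.
Proof.
apply: (so_morphism_continuous (lower_semilattice_over Xd) lower_ext_join Yv.1).
  move=> A B /lower_leP AB; apply/lower_ext_lub => a /AB.
  by move: a; apply/lower_ext_lub; exact: spec_le_refl.
by rewrite lower_ext_eta.
Qed.

End LowerExtension.

Section UpperExtension.
Variables (X Y : topologicalType) (meet : Y -> Y -> Y) (g : X -> Y).
Hypotheses (Xd : directed_space X) (Yw : wedge_directed meet).
Hypothesis (gc : continuous g).
Local Notation F := (upper_ext meet g).
Let Y0 : kolmogorov_space Y := (dsl_space Yw.1).1.

Lemma upper_ext_glb A z :
  spec_le z (F A) <-> forall a, upper_set A a -> spec_le z (g a).
Proof.
have [G [fG G0 AG]] := upper_setP A.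
rewrite (_ : A = upper_fin fG G0); last exact: upper_eq.
rewrite upper_ext_fin //.
rewrite (fold_set_lub (R := fun x y : Y => spec_le y x)) //.
- split=> H a; last by move=> Ga; apply: H; exact: upsetS.
  by move=> [b /H zb ba]; exact: spec_le_trans zb (continuous_spec_le gc ba).
- exact: dsl_idempotent Yw.1.
- by case: Yw.
- exact: dsl_commutative Yw.1.
- by move=> x x' y y'; exact: directed_semilattice_mono Yw.1.
- by move=> y x z' xy yz; exact: spec_le_trans xy.
Qed.

Lemma upper_ext_meet : {morph F : A B / upper_meet A B >-> meet A B}.
Proof.
move=> A B; apply: (spec_le_eq_lb Y0) => z.
rewrite upper_ext_glb (wedge_directed_glb _ _ _ Yw) !upper_ext_glb.
split=> [H|[HA HB] a [/HA|/HB]//].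
by split=> a Aa; apply: H; [left|right].
Qed.

Lemma upper_ext_eta : F \o @eta_wedge X = g.
Proof.
apply/funext => x; apply: (spec_le_eq_lb Y0) => z /=; rewrite upper_ext_glb.
split=> [|gz a /eta_wedgeE ax]; first by apply; exact/eta_wedgeE/spec_le_refl.
exact: spec_le_trans gz (continuous_spec_le gc ax).
Qed.

Lemma upper_ext_continuous : continuous F.
Proof.
apply: (so_morphism_continuous (upper_semilattice_over Xd) upper_ext_meet Yw.1).
  move=> A B /upper_leP AB; apply/upper_ext_glb => a /AB.
  by move: a; apply/upper_ext_glb; exact: spec_le_refl.
by rewrite upper_ext_eta.
Qed.

End UpperExtension.

(** * The free distributive lattices *)

Section LowerUpper.
Variables (X : topologicalType) (Xd : directed_space X).
Let Uw := upper_wedge_directed Xd.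
Let Ud : directed_space (upper_powerspace X) := dsl_space Uw.1.
Let So := lower_semilattice_over Ud.
Local Notation eta := (@eta_vee (upper_powerspace X) \o @eta_wedge X).

Lemma lower_upper_ext (Y : topologicalType) (joinY meetY : Y -> Y -> Y)
    (f : X -> Y) :
  vee_wedge_directed joinY meetY -> continuous f ->
  let F := lower_ext joinY (upper_ext meetY f) in
  vee_wedge_morphism (@lower_join (upper_powerspace X)) (lower_cap Uw)
    joinY meetY F /\ F \o eta = f.
Proof.
move=> YL fc F; have [Yv Yw _] := YL.
have gc := upper_ext_continuous Xd Yw fc; have gM := upper_ext_meet Yw fc.
have Feta := lower_ext_eta Yv gc; have FM := lower_ext_join Yv gc.
have Fc : continuous F by exact: lower_ext_continuous.
split; last by rewrite /F compA Feta upper_ext_eta.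
split; split=> //.
apply: (so_morphism_second So FM) => [||||A B].
- exact: lower_capC.
- exact: dsl_commutative Yw.1.
- exact: lower_cap_distr.
- exact: vee_wedge_meet_distr YL.
- have FE C : lower_ext joinY (upper_ext meetY f) (eta_vee C) =
      upper_ext meetY f C := congr1 (@^~ C) Feta.
  by rewrite -eta_vee_meet !FE; exact: gM.
Qed.

(** A morphism on [P_L(P_U(X))] is determined by its restriction along
    [eta_vee]; since [eta_vee] preserves infima, the restriction preserves
    them too and is determined by its values on [X]. *)
Lemma lower_upper_unique (Y : topologicalType) (joinY meetY : Y -> Y -> Y)
    (F G : lower_powerspace (upper_powerspace X) -> Y) :
  vee_wedge_morphism (@lower_join _) (lower_cap Uw) joinY meetY F ->
  vee_wedge_morphism (@lower_join _) (lower_cap Uw) joinY meetY G ->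
  F \o eta = G \o eta -> F = G.
Proof.
move=> [[_ Fj] [_ Fm]] [[_ Gj] [_ Gm]] FG.
apply: (so_morphism_unique So Fj Gj).
suff -> : F \o @eta_vee _ = G \o @eta_vee _ by [].
apply: (so_morphism_unique (upper_semilattice_over Xd) (opY := meetY)).
- by move=> A B /=; rewrite (eta_vee_meet Uw) Fm.
- by move=> A B /=; rewrite (eta_vee_meet Uw) Gm.
- exact: (fun x => congr1 (fun h : X -> Y => h x) FG).
Qed.

Lemma lower_upper_free :
  free_vee_wedge_directed (@lower_join _) (lower_cap Uw) eta.
Proof.
split; first exact: lower_vee_wedge_directed.
  move=> x; apply: continuous_comp.
    exact: so_eta_continuous Xd (upper_semilattice_over Xd) _.
  exact: so_eta_continuous Ud So _.
move=> Y joinY meetY YL f fc; have [FM Feta] := lower_upper_ext YL fc.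
exists (lower_ext joinY (upper_ext meetY f)); split=> // G [GM Geta].
by apply: lower_upper_unique FM GM _; rewrite Feta Geta.
Qed.

End LowerUpper.

Section UpperLower.
Variables (X : topologicalType) (Xd : directed_space X).
Let Lv := lower_vee_directed Xd.
Let Ld : directed_space (lower_powerspace X) := dsl_space Lv.1.
Let So := upper_semilattice_over Ld.
Local Notation eta := (@eta_wedge (lower_powerspace X) \o @eta_vee X).

Lemma upper_lower_ext (Y : topologicalType) (joinY meetY : Y -> Y -> Y)
    (f : X -> Y) :
  vee_wedge_directed joinY meetY -> continuous f ->
  let F := upper_ext meetY (lower_ext joinY f) in
  vee_wedge_morphism (upper_cap Lv) (@upper_meet (lower_powerspace X))
    joinY meetY F /\ F \o eta = f.
Proof.
move=> YL fc F; have [Yv Yw _] := YL.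
have gc := lower_ext_continuous Xd Yv fc; have gM := lower_ext_join Yv fc.
have Feta := upper_ext_eta Yw gc; have FM := upper_ext_meet Yw gc.
have Fc : continuous F by exact: upper_ext_continuous.
split; last by rewrite /F compA Feta lower_ext_eta.
split; split=> //.
apply: (so_morphism_second So FM) => [||||A B].
- exact: upper_capC.
- exact: dsl_commutative Yv.1.
- exact: upper_cap_distr.
- exact: vee_wedge_join_distr YL.
- have FE C : upper_ext meetY (lower_ext joinY f) (eta_wedge C) =
      lower_ext joinY f C := congr1 (@^~ C) Feta.
  by rewrite -eta_wedge_join !FE; exact: gM.
Qed.

Lemma upper_lower_unique (Y : topologicalType) (joinY meetY : Y -> Y -> Y)
    (F G : upper_powerspace (lower_powerspace X) -> Y) :
  vee_wedge_morphism (upper_cap Lv) (@upper_meet _) joinY meetY F ->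
  vee_wedge_morphism (upper_cap Lv) (@upper_meet _) joinY meetY G ->
  F \o eta = G \o eta -> F = G.
Proof.
move=> [[_ Fj] [_ Fm]] [[_ Gj] [_ Gm]] FG.
apply: (so_morphism_unique So Fm Gm).
suff -> : F \o @eta_wedge _ = G \o @eta_wedge _ by [].
apply: (so_morphism_unique (lower_semilattice_over Xd) (opY := joinY)).
- by move=> A B /=; rewrite (eta_wedge_join Lv) Fj.
- by move=> A B /=; rewrite (eta_wedge_join Lv) Gj.
- exact: (fun x => congr1 (fun h : X -> Y => h x) FG).
Qed.

Lemma upper_lower_free :
  free_vee_wedge_directed (upper_cap Lv) (@upper_meet _) eta.
Proof.
split; first exact: upper_vee_wedge_directed.
  move=> x; apply: continuous_comp.
    exact: so_eta_continuous Xd (lower_semilattice_over Xd) _.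
  exact: so_eta_continuous Ld So _.
move=> Y joinY meetY YL f fc; have [FM Feta] := upper_lower_ext YL fc.
exists (upper_ext meetY (lower_ext joinY f)); split=> // G [GM Geta].
by apply: upper_lower_unique FM GM _; rewrite Feta Geta.
Qed.

End UpperLower.

Lemma vee_wedge_morphism_id (Z : topologicalType) (join meet : Z -> Z -> Z) :
  vee_wedge_morphism join meet join meet id.
Proof. by split; split=> // x; exact: cvg_id. Qed.

Lemma vee_wedge_morphism_comp (Z1 Z2 Z3 : topologicalType)
    (j1 m1 : Z1 -> Z1 -> Z1) (j2 m2 : Z2 -> Z2 -> Z2) (j3 m3 : Z3 -> Z3 -> Z3)
    (F : Z1 -> Z2) (G : Z2 -> Z3) :
  vee_wedge_morphism j1 m1 j2 m2 F -> vee_wedge_morphism j2 m2 j3 m3 G ->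
  vee_wedge_morphism j1 m1 j3 m3 (G \o F).
Proof.
move=> [[Fc Fj] [_ Fm]] [[Gc Gj] [_ Gm]].
have GFc : continuous (G \o F).
  by move=> x; apply: continuous_comp; [exact: Fc|exact: Gc].
by split; split=> // x y /=; rewrite ?Fj ?Gj ?Fm ?Gm.
Qed.

(** Each composite extends the unit of its own space, as does the identity, and
    such an extension is unique. *)
Lemma free_vee_wedge_directed_iso (X Z1 Z2 : topologicalType)
    (j1 m1 : Z1 -> Z1 -> Z1) (j2 m2 : Z2 -> Z2 -> Z2)
    (eta1 : X -> Z1) (eta2 : X -> Z2) :
  free_vee_wedge_directed j1 m1 eta1 -> free_vee_wedge_directed j2 m2 eta2 ->
  exists (i : Z1 -> Z2) (j : Z2 -> Z1),
    [/\ vee_wedge_morphism j1 m1 j2 m2 i, vee_wedge_morphism j2 m2 j1 m1 j,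
        cancel i j, cancel j i & forall x, i (eta1 x) = eta2 x].
Proof.
move=> [L1 c1 free1] [L2 c2 free2].
have [i [[iM ie] _]] := free1 _ _ _ L2 _ c2.
have [j [[jM je] _]] := free2 _ _ _ L1 _ c1.
exists i, j; split=> //; last by move=> x; rewrite -ie.
  have [k [_ ku]] := free1 _ _ _ L1 _ c1; move=> x.
  rewrite -[RHS]/(id x) -(ku id); last first.
  by split; [exact: vee_wedge_morphism_id|].
  rewrite (ku (j \o i)) //; split; first exact: vee_wedge_morphism_comp iM jM.
  by rewrite -compA ie.
have [k [_ ku]] := free2 _ _ _ L2 _ c2; move=> x.
rewrite -[RHS]/(id x) -(ku id); last first.
  by split; [exact: vee_wedge_morphism_id|].
rewrite (ku (i \o j)) //; split; first exact: vee_wedge_morphism_comp jM iM.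
by rewrite -compA je.
Qed.

Theorem theorem9p4 (X : topologicalType) (Xdir : directed_space X) :
  exists (meetLU : lower_powerspace (upper_powerspace X) ->
                   lower_powerspace (upper_powerspace X) ->
                   lower_powerspace (upper_powerspace X))
         (joinUL : upper_powerspace (lower_powerspace X) ->
                   upper_powerspace (lower_powerspace X) ->
                   upper_powerspace (lower_powerspace X)),
  [/\ free_vee_wedge_directed (@lower_join (upper_powerspace X)) meetLU
        (@eta_vee (upper_powerspace X) \o @eta_wedge X) /\
      (forall (Y : topologicalType) (joinY meetY : Y -> Y -> Y),
         vee_wedge_directed joinY meetY ->
         forall f : X -> Y, continuous f ->
         let F := lower_ext joinY (upper_ext meetY f) in
         vee_wedge_morphism (@lower_join (upper_powerspace X)) meetLU
           joinY meetY F /\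
         F \o (@eta_vee (upper_powerspace X) \o @eta_wedge X) = f),
      free_vee_wedge_directed joinUL (@upper_meet (lower_powerspace X))
        (@eta_wedge (lower_powerspace X) \o @eta_vee X) /\
      (forall (Y : topologicalType) (joinY meetY : Y -> Y -> Y),
         vee_wedge_directed joinY meetY ->
         forall f : X -> Y, continuous f ->
         let F := upper_ext meetY (lower_ext joinY f) in
         vee_wedge_morphism joinUL (@upper_meet (lower_powerspace X))
           joinY meetY F /\
         F \o (@eta_wedge (lower_powerspace X) \o @eta_vee X) = f) &
      exists (i : upper_powerspace (lower_powerspace X) ->
                  lower_powerspace (upper_powerspace X))
             (j : lower_powerspace (upper_powerspace X) ->
                  upper_powerspace (lower_powerspace X)),
        [/\ vee_wedge_morphism joinUL (@upper_meet (lower_powerspace X))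
              (@lower_join (upper_powerspace X)) meetLU i,
            vee_wedge_morphism (@lower_join (upper_powerspace X)) meetLU
              joinUL (@upper_meet (lower_powerspace X)) j,
            cancel i j, cancel j i &
            forall x : X, i (eta_wedge (eta_vee x)) = eta_vee (eta_wedge x)]].
Proof.
exists (lower_cap (upper_wedge_directed Xdir)).
exists (upper_cap (lower_vee_directed Xdir)); split.
- by split; [exact: lower_upper_free|move=> Y jY mY YL f; exact: lower_upper_ext].
- by split; [exact: upper_lower_free|move=> Y jY mY YL f; exact: upper_lower_ext].
exact: free_vee_wedge_directed_iso (upper_lower_free Xdir) (lower_upper_free Xdir).
Qed.
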